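(* Let $(Z_t)_{t\ge0}$ be i.i.d. de Finetti sequences with measure $\nu$ and let $(X_t)$ be the random walk $X_{t+1}=X_t+Z_t\bmod2$ on $\{0,1\}^\infty$, where $X_0$ is a de Finetti sequence with measure $\varphi_0$. Then $X_t$, $t\ge0$, are de Finetti sequences with measures $\varphi_t$ such that for each measurable set $A\subseteq[-1,1]$ $$\int_A\varphi^{[-1,1]}_{t+1}(d\psi_{t+1})=\int_{\xi\psi_t\in A}\nu^{[-1,1]}(d\xi)\,\varphi_t^{[-1,1]}(d\psi_t),\qquad t=0,1,2,\dots,$$ with the recursive solution $$\int_A\varphi_t^{[-1,1]}(d\psi_t)=\int_{\prod_{k=0}^t\psi_k\in A}\ \otimes_{k=1}^t\nu^{[-1,1]}(d\psi_k)\otimes\varphi_0^{[-1,1]}(d\psi_0),$$ where $\varphi_0^{[-1,1]}$ is the initial spin measure. The de Finetti measure $\varphi_t$ after the $t$-th transition is specified by $$\int_A\varphi_t(d\omega)=\int_{\frac{1-\psi}2\in A}\varphi_t^{[-1,1]}(d\psi)$$ for measurable sets $A\subseteq[0,1]$.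
   Context: A de Finetti sequence with measure $\mu$ (a probability measure on $[0,1]$) is an exchangeable $\{0,1\}$-valued sequence which, conditionally on $\omega$ with law $\mu$, is i.i.d. Bernoulli$(\omega)$. For a probability measure $\mu$ on $[0,1]$, $\mu^{[-1,1]}$ denotes the law of $1-2\omega$ when $\omega$ has law $\mu$, i.e. $\int_B\mu^{[-1,1]}(d\xi)=\int_{1-2\omega\in B}\mu(d\omega)$ for measurable $B\subseteq[-1,1]$. Addition mod 2 is entrywise, and $Z_t$ is independent of $(X_\tau)_{\tau\le t}$. *)

(* Defs.v *)
From HB Require Import structures.
From mathcomp Require Import all_boot all_order all_algebra.
From mathcomp Require Import finmap.
From mathcomp Require Import all_classical all_reals all_analysis.
From mathcomp Require Import measurable_realfun.

Set Implicit Arguments.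
Unset Strict Implicit.
Unset Printing Implicit Defensive.

Import Order.TTheory GRing.Theory Num.Theory.
Import numFieldNormedType.Exports.

Local Open Scope classical_set_scope.
Local Open Scope ring_scope.
Local Open Scope ereal_scope.

(* {0,1}^oo with its product sigma-algebra, generated by the coordinates *)
Definition coordinate_sets : set (set (nat -> bool)) :=
  [set S | exists i (B : set bool), S = [set x | B (x i)]].

Definition binseq := g_sigma_algebraType coordinate_sets.

Definition addseq (x y : binseq) : binseq := fun i => x i (+) y i.

Definition mutually_independent d d' (T : measurableType d)
    (T' : measurableType d') (R : realType) (P : {measure set T -> \bar R})
    (I : choiceType) (Y : I -> T -> T') : Prop :=
  forall (J : {fset I}) (B : I -> set T'),
    (forall i, i \in J -> measurable (B i)) ->
    P (\bigcap_(i in [set` J]) Y i @^-1` B i) =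
    \prod_(i <- J) P (Y i @^-1` B i).

Definition independent d d1 d2 (T : measurableType d) (T1 : measurableType d1)
    (T2 : measurableType d2) (R : realType) (P : {measure set T -> \bar R})
    (U : T -> T1) (V : T -> T2) : Prop :=
  forall A B, measurable A -> measurable B ->
    P (U @^-1` A `&` V @^-1` B) = P (U @^-1` A) * P (V @^-1` B).

Definition identically_distributed d d' (T : measurableType d)
    (T' : measurableType d') (R : realType) (P : {measure set T -> \bar R})
    (I : Type) (Y : I -> T -> T') : Prop :=
  forall i j S, measurable S -> P (Y i @^-1` S) = P (Y j @^-1` S).

Definition iid d d' (T : measurableType d) (T' : measurableType d')
    (R : realType) (P : {measure set T -> \bar R}) (I : choiceType)
    (Y : I -> T -> T') : Prop :=
  mutually_independent P Y /\ identically_distributed P Y.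

Definition exchangeable d (T : measurableType d) (R : realType)
    (P : probability T R) (Y : T -> binseq) : Prop :=
  forall s : nat -> nat, bijective s ->
    (exists n, forall i, (n <= i)%N -> s i = i) ->
    forall S, measurable S ->
      P ((fun w => (Y w \o s : binseq)) @^-1` S) = P (Y @^-1` S).

Definition iid_bernoulli (R : realType) (Q : {measure set binseq -> \bar R})
    (p : R) : Prop :=
  mutually_independent Q (fun (i : nat) (x : binseq) => x i) /\
  forall i (B : set bool), Q [set x | B (x i)] = bernoulli_prob p B.

(* [kappa p] is the conditional law of the sequence given that the random
   parameter equals [p]; the joint law of (parameter, sequence) is
   mu(dp) kappa(p, dx), so the parameter need not live on [T].
   The values of [kappa] outside [0, 1] are irrelevant, [mu] being carried by
   [0, 1] below. *)
Definition conditionally_iid_bernoulli d (T : measurableType d) (R : realType)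
    (P : probability T R) (Y : T -> binseq) (mu : probability R R) : Prop :=
  exists kappa : R.-pker R ~> binseq,
    (forall p : R, (0 <= p <= 1)%R -> iid_bernoulli (kappa p) p) /\
    forall S, measurable S -> P (Y @^-1` S) = \int[mu]_p kappa p S.

Definition de_finetti d (T : measurableType d) (R : realType)
    (P : probability T R) (Y : T -> binseq) (mu : probability R R) : Prop :=
  [/\ mu `[0%R, 1%R]%classic = 1, measurable_fun [set: T] Y, exchangeable P Y &
      conditionally_iid_bernoulli P Y mu].

(* 1 - 2 w is the mean of (-1)^b for b Bernoulli(w); it maps [0, 1] onto
   [-1, 1]. *)
Definition spin (R : realType) (w : R) : R := (1 - 2 * w)%R.

Lemma measurable_spin (R : realType) : measurable_fun [set: R] (@spin R).
Proof. by apply: measurable_funB => //; exact: measurable_funM. Qed.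

HB.instance Definition _ (R : realType) :=
  isMeasurableFun.Build _ _ R R (@spin R) (@measurable_spin R).

Definition spin_law (R : realType) (mu : probability R R) : probability R R :=
  distribution mu (@spin R).

Definition cons_pair (R : realType) n (p : R * n.-tuple R) : n.+1.-tuple R :=
  [tuple of p.1 :: p.2].

Lemma measurable_cons_pair (R : realType) n :
  measurable_fun [set: R * n.-tuple R] (@cons_pair R n).
Proof. exact: measurable_cons. Qed.

HB.instance Definition _ (R : realType) n :=
  isMeasurableFun.Build _ _ (R * n.-tuple R)%type (n.+1.-tuple R)
    (@cons_pair R n) (@measurable_cons_pair R n).

(* m_0 (x) m_1 (x) ... (x) m_(n-1), factor k governing the coordinate tnth _ k *)
Fixpoint tuple_product (R : realType) (m : nat -> probability R R) (n : nat) :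
    probability (n.-tuple R) R :=
  match n with
  | 0 => \d_([tuple] : 0.-tuple R)
  | n.+1 => distribution (m 0%N \x tuple_product (fun k => m k.+1) n)
                         (@cons_pair R n)
  end.

(* Main.v *)
Require Import Defs.
From HB Require Import structures.
From mathcomp Require Import all_boot all_order all_algebra.
From mathcomp Require Import finmap.
From mathcomp Require Import all_classical all_reals all_analysis.
From mathcomp Require Import measurable_realfun ring lra.
Import Order.TTheory GRing.Theory Num.Theory.
Import numFieldNormedType.Exports.

(** Why it holds. If x and y are independent i.i.d. Bernoulli sequences with
    parameters p and q, then x + y mod 2 is again i.i.d. Bernoulli, with the
    parameter r = p (1 - q) + q (1 - p): an entry of the sum is 1 exactly when
    one of the two summands is. In the spin variable 1 - 2 p, the mean of
    (-1)^b, this rule is multiplicative: 1 - 2 r = (1 - 2 p) (1 - 2 q).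
    Averaging over independent p and q, the sum of two independent de Finetti
    sequences is de Finetti, and its measure is the image of the product of the
    two measures under (p, q) |-> r [de_finetti_addseq]. Along the walk, [phi]
    is therefore obtained from [phi0] by iterating this operation with [nu]
    [walk_measure], and the spin laws get convolved multiplicatively.

    The closure under addition is proved on cylinders, which determine a
    measure on {0,1}^oo [law_determined_by_cylinders]. An event that prescribes
    the first n entries of the sum is a disjoint union over the 2^n possible
    initial segments a of one summand; independence turns its probability into
    a sum over a of products, and distributivity refolds that sum into a product
    of n Bernoulli probabilities with parameter r [prod_bernoulli_pmf_xor].
    The conditional law of the sum given r can be taken to be the kernel that
    already describes one of the summands, so no Bernoulli sequence has to be
    constructed. Exchangeability follows from the mixture representation, since
    an i.i.d. law gives the same mass to a cylinder and to its reindexings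
    [conditionally_iid_exchangeable].

    For the explicit solution, the product measure puts [phi0] in front and adds
    a new factor [nu] right behind it, whereas the recursion adds [nu] in front
    of everything; Tonelli's theorem and commutativity of the product of reals
    reconcile the two [spin_law_walk_measure]. *)

Set Implicit Arguments.
Unset Strict Implicit.
Unset Printing Implicit Defensive.
Unset SsrOldRewriteGoalsOrder.

Local Open Scope classical_set_scope.
Local Open Scope ring_scope.
Local Open Scope ereal_scope.

(** * Cylinders and measurability in {0,1}^oo *)

Definition cylinder (n : nat) (b : nat -> bool) : set binseq :=
  [set x | forall i, (i < n)%N -> x i = b i].

Definition cylinders : set (set binseq) :=
  [set S | S = set0 \/ exists n b, S = cylinder n b].

Lemma measurable_coordinate (i : nat) :
  measurable_fun [set: binseq] (fun x : binseq => x i).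
Proof.
by move=> _ B _; rewrite setTI; apply: sub_sigma_algebra; exists i, B.
Qed.

Lemma measurable_finitely_many_coordinates (s : nat -> nat) n
    (b : nat -> bool) :
  measurable ([set x | forall i, (i < n)%N -> x (s i) = b i] : set binseq).
Proof.
rewrite [X in measurable X](_ : _ =
    \bigcap_(i in `I_n) [set x : binseq | x (s i) = b i]).
  by apply/seteqP; split=> x /= Hx i; exact: Hx.
apply: bigcap_measurableType => i _.
rewrite -[X in measurable X]setTI.
exact: (@measurable_coordinate (s i) measurableT [set b i]).
Qed.

Lemma measurable_cylinder n b : measurable (cylinder n b).
Proof. exact: (measurable_finitely_many_coordinates id). Qed.

Lemma measurable_to_binseq d (T : measurableType d) (Y : T -> binseq) :
  (forall i, measurable_fun [set: T] (fun w => Y w i)) ->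
  measurable_fun [set: T] Y.
Proof.
move=> mY; apply: (@measurability _ _ _ _ [set: T] Y coordinate_sets) => //.
move=> _ [_ [i [B ->]] <-].
exact: mY.
Qed.

Lemma measurable_addseq d (T : measurableType d) (U V : T -> binseq) :
  measurable_fun [set: T] U -> measurable_fun [set: T] V ->
  measurable_fun [set: T] (fun w => addseq (U w) (V w)).
Proof.
move=> mU mV; apply: measurable_to_binseq => i.
have mi (W : T -> binseq) (mW : measurable_fun [set: T] W) :
    measurable_fun [set: T] (fun w => W w i).
  exact: (measurableT_comp (measurable_coordinate i) mW).
rewrite /addseq.
apply: (@measurableT_comp _ _ _ _ _ _ (fun p : bool * bool => p.1 (+) p.2) _
  (fun w => (U w i, V w i))).
  move=> _ B _; rewrite setTI.
  rewrite (_ : _ @^-1` B =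
      \bigcup_(p in [set p : bool * bool | B (p.1 (+) p.2)]) ([set p.1] `*` [set p.2])).
    by apply/seteqP; split=> [p Bp|p [q Bq [/= -> ->]]] //; exists p.
  apply: fin_bigcup_measurable => // p _.
  exact: measurableX.
by apply: measurable_fun_pair; exact: mi.
Qed.

Lemma measurable_comp_indices (s : nat -> nat) :
  measurable_fun [set: binseq] (fun x : binseq => (x \o s : binseq)).
Proof.
by apply: measurable_to_binseq => i; exact: measurable_coordinate.
Qed.

(** Two cylinders are either incompatible or nested, which is why the empty set
    is included in the system. *)
Lemma cylinders_setI : setI_closed cylinders.
Proof.
have le n b m c : (n <= m)%N -> cylinders (cylinder n b `&` cylinder m c).
  move=> nm; have [bc|] := pselect (forall i, (i < n)%N -> c i = b i).
    right; exists m, c; apply/seteqP; split=> [x []//|x xc]; split=> // i ni.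
    by rewrite xc ?bc// (leq_trans ni).
  move=> nbc; left; apply/seteqP; split=> // x [xb xc]; apply: nbc => i ni.
  by rewrite -xb// xc// (leq_trans ni).
move=> _ _ [->|[n [b ->]]] [->|[m [c ->]]]; rewrite ?set0I ?setI0; try by left.
have [nm|/ltnW mn] := leqP n m; first exact: le.
by rewrite setIC; exact: le.
Qed.

(** Words of length n are used as a finite index set for sums; cylinders are
    indexed by infinite sequences, whose entries from n on are immaterial. *)
Definition extend_bits n (a : {ffun 'I_n -> bool}) (i : nat) : bool :=
  if insub i is Some j then a j else false.

Lemma extend_bitsE n (a : {ffun 'I_n -> bool}) (i : 'I_n) :
  extend_bits a i = a i.
Proof.
by rewrite /extend_bits; case: insubP => [j _ /val_inj ->//|]; rewrite ltn_ord.
Qed.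

(** A coordinate event is the finite union of the cylinders given by the words
    ending in an admissible bit. *)
Lemma measurable_binseqE : @measurable _ binseq = <<s cylinders >>.
Proof.
apply/seteqP; split; last first.
  apply: smallest_sub; first exact: sigma_algebra_measurable.
  by move=> _ [->|[n [b ->]]]; [exact: measurable0|exact: measurable_cylinder].
apply: smallest_sub; first exact: smallest_sigma_algebra.
move=> _ [i [B ->]].
rewrite (_ : [set _ | _] = \bigcup_(a in [set a : {ffun 'I_i.+1 -> bool} |
     B (a ord_max)]) cylinder i.+1 (extend_bits a)).
  apply/seteqP; split=> [x Bx|x [a /= Ba /(_ i (ltnSn i)) ->]]; last first.
    by rewrite (extend_bitsE a ord_max).
  exists [ffun j : 'I_i.+1 => x j]; rewrite /= ?ffunE// => j ji.
  by rewrite (extend_bitsE _ (Ordinal ji)) ffunE.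
pose CT : ringOfSetsType cylinders.-sigma := g_sigma_algebraType cylinders.
apply: (@fin_bigcup_measurable _ CT) => // a _.
by apply: sub_sigma_algebra; right; eexists; eexists.
Qed.

(** Uniqueness of finite measures on a pi-system; the whole space is the
    cylinder of length 0. *)
Lemma binseq_measure_unique (R : realType)
    (m1 m2 : {measure set binseq -> \bar R}) :
  m1 [set: binseq] < +oo ->
  (forall n b, m1 (cylinder n b) = m2 (cylinder n b)) ->
  forall S, measurable S -> m1 S = m2 S.
Proof.
move=> fin1 m12.
apply: (measure_unique cylinders (fun=> cylinder 0 xpredT)).
- exact: measurable_binseqE.
- exact: cylinders_setI.
- by move=> _; right; eexists; eexists.
- by apply/seteqP; split=> // x _; exists 0%N.
- by move=> _ [->|[n [b ->]]]; rewrite ?measure0.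
- move=> _; apply: le_lt_trans fin1; apply: le_measure => //; rewrite inE//.
  exact: measurable_cylinder.
Qed.

Lemma law_determined_by_cylinders (R : realType) d (T : measurableType d)
    (P : probability T R) (Y : T -> binseq)
    (m : {measure set binseq -> \bar R}) :
  measurable_fun [set: T] Y ->
  (forall n b, P (Y @^-1` cylinder n b) = m (cylinder n b)) ->
  forall S, measurable S -> P (Y @^-1` S) = m S.
Proof.
move=> mY PYm.
pose Y' : {mfun T >-> binseq} := HB.pack Y (isMeasurableFun.Build _ _ _ _ Y mY).
apply: (@binseq_measure_unique R (distribution P Y') m) => //.
by apply: le_lt_trans (ltry 1); exact: probability_le1.
Qed.

(** * Laws of i.i.d. Bernoulli sequences and their mixtures *)

(** Injectivity of the reindexing makes the n constraints bear on n distinct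
    coordinates, so that mutual independence applies. *)
Lemma iid_bernoulli_reindexed_cylinder (R : realType)
    (Q : {measure set binseq -> \bar R}) (p : R) (s g : nat -> nat) n
    (b : nat -> bool) :
  (0 <= p <= 1)%R -> iid_bernoulli Q p -> cancel s g ->
  Q [set x : binseq | forall i, (i < n)%N -> x (s i) = b i] =
  (\prod_(i < n) bernoulli_pmf p (b i))%:E.
Proof.
move=> p01 [indQ margQ] sK.
(* The left inverse of s tells which bit is prescribed at a coordinate of J. *)
pose J := [fset s i | i in iota 0 n]%fset.
rewrite (_ : [set x | _] =
    \bigcap_(j in [set` J]) (fun x : binseq => x j) @^-1` [set b (g j)]).
  apply/seteqP; split=> x /= Hx.
    move=> j /= /imfsetP[i /=]; rewrite mem_iota add0n => /andP[_ ni] ->.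
    by rewrite sK; exact: Hx.
  move=> i ni; have /Hx /= : [set` J] (s i).
    by apply/imfsetP; exists i => //=; rewrite mem_iota add0n ni.
  by rewrite sK.
rewrite indQ// big_imfset/=; first by move=> i j _ _ /(can_inj sK).
rewrite undup_id ?iota_uniq//.
rewrite -[X in iota 0 X]subn0 -/(index_iota 0 n) big_mkord -prodEFin.
apply: eq_bigr => i _.
have /= := margQ (s i) [set b i]; rewrite /preimage sK => ->.
by rewrite /bernoulli_prob p01 fsbig_set1.
Qed.

Lemma iid_bernoulli_cylinder (R : realType)
    (Q : {measure set binseq -> \bar R}) (p : R) n (b : nat -> bool) :
  (0 <= p <= 1)%R -> iid_bernoulli Q p ->
  Q (cylinder n b) = (\prod_(i < n) bernoulli_pmf p (b i))%:E.
Proof.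
move=> p01 Qp.
exact: (@iid_bernoulli_reindexed_cylinder R Q p id id n b p01 Qp).
Qed.

(** The law of a random element whose conditional law given a parameter of law
    mu is kappa; this is the right-hand side of
    [conditionally_iid_bernoulli], packaged as a measure so that uniqueness of
    measures applies to it. *)
Definition mixture (R : realType) d d' (X : measurableType d)
    (Y : measurableType d') (mu : {measure set X -> \bar R})
    (kappa : R.-ker X ~> Y) (S : set Y) : \bar R :=
  \int[mu]_x kappa x S.

Section mixture_measure.
Context (R : realType) d d' (X : measurableType d) (Y : measurableType d').
Variables (mu : {measure set X -> \bar R}) (kappa : R.-ker X ~> Y).

Let mixture0 : mixture mu kappa set0 = 0.
Proof. by apply: integral0_eq => x _; rewrite measure0. Qed.

Let mixture_ge0 S : 0 <= mixture mu kappa S.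
Proof. exact: integral_ge0. Qed.

Let mixture_semi_sigma_additive : semi_sigma_additive (mixture mu kappa).
Proof.
move=> F mF tF mUF.
rewrite [X in _ --> X](_ : _ = \sum_(n <oo) mixture mu kappa (F n)).
  rewrite /mixture -integral_nneseries//.
    by move=> n; exact: measurable_kernel.
  apply: eq_integral => x _.
  by rewrite measure_semi_bigcup.
apply: is_cvg_ereal_nneg_natsum => n _; exact: integral_ge0.
Qed.

HB.instance Definition _ := isMeasure.Build _ _ _ (mixture mu kappa)
  mixture0 mixture_ge0 mixture_semi_sigma_additive.

End mixture_measure.

(** Kernels are only known to be Bernoulli for parameters in [0, 1], so
    integrands agree there only; the mixing measures are carried by [0, 1]. *)
Lemma integral_eq_on_full_set (R : realType) d (T : measurableType d)
    (m : probability T R) (D : set T) (f g : T -> \bar R) :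
  measurable D -> m D = 1 ->
  measurable_fun [set: T] f -> measurable_fun [set: T] g ->
  (forall x, D x -> f x = g x) ->
  \int[m]_x f x = \int[m]_x g x.
Proof.
move=> mD mD1 mf mg fg; apply: ae_eq_integral => //.
exists (~` D); split; first exact: measurableC.
  transitivity (1 - m D); first exact: probability_setC.
  by rewrite mD1 subee.
by move=> x /= nfg Dx; apply: nfg => _; exact: fg.
Qed.

(** Given the parameter, a cylinder and its reindexing both have the mass
    prescribed by independence, hence the same mass after mixing. *)
Lemma conditionally_iid_exchangeable (R : realType) d (T : measurableType d)
    (P : probability T R) (Y : T -> binseq) (mu : probability R R) :
  measurable_fun [set: T] Y -> mu `[0%R, 1%R]%classic = 1 ->
  conditionally_iid_bernoulli P Y mu -> exchangeable P Y.
Proof.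
move=> mY mu01 [kappa [iidk PY]] s [g sK gK] _ S mS.
rewrite PY//.
apply: (law_determined_by_cylinders (m := mixture mu kappa)) => //.
  exact: measurableT_comp (measurable_comp_indices s) mY.
move=> n b.
pose C : set binseq := [set x | forall i, (i < n)%N -> x (s i) = b i].
have mC : measurable C by exact: measurable_finitely_many_coordinates.
rewrite -[LHS]/(P (Y @^-1` C)) PY// -[RHS]/(\int[mu]_p kappa p (cylinder n b)).
have := integral_eq_on_full_set (m := mu) (D := `[0%R, 1%R]%classic)
  (f := kappa^~ C) (g := kappa^~ (cylinder n b)); apply => //.
- exact: (measurable_kernel kappa _ mC).
- exact: (measurable_kernel kappa _ (measurable_cylinder n b)).
move=> p /=; rewrite in_itv /= => p01.
rewrite (iid_bernoulli_reindexed_cylinder n b p01 (iidk p p01) sK).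
by rewrite (iid_bernoulli_cylinder n b p01 (iidk p p01)).
Qed.

(** * Addition mod 2 of independent de Finetti sequences *)

(** The probability that the sum mod 2 of independent Bernoulli variables with
    parameters p and q equals 1. *)
Definition xor_parameter (R : realType) (pq : R * R) : R :=
  (pq.1 * (1 - pq.2) + pq.2 * (1 - pq.1))%R.

Lemma measurable_xor_parameter (R : realType) :
  measurable_fun [set: R * R] (@xor_parameter R).
Proof.
by apply: measurable_funD; apply: measurable_funM => //;
  apply: measurable_funB.
Qed.

HB.instance Definition _ (R : realType) :=
  isMeasurableFun.Build _ _ (R * R)%type R (@xor_parameter R)
    (@measurable_xor_parameter R).

Lemma spin_xor_parameter (R : realType) (pq : R * R) :
  spin (xor_parameter pq) = (spin pq.1 * spin pq.2)%R.
Proof. by rewrite /spin /xor_parameter; ring. Qed.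

Lemma xor_parameter_itv01 (R : realType) (p q : R) :
  (0 <= p <= 1)%R -> (0 <= q <= 1)%R -> (0 <= xor_parameter (p, q) <= 1)%R.
Proof.
rewrite /xor_parameter /= => /andP[p0 p1] /andP[q0 q1].
by apply/andP; split; nra.
Qed.

Lemma bernoulli_pmf_xor (R : realType) (p q : R) (b : bool) :
  bernoulli_pmf (xor_parameter (p, q)) b =
  (\sum_(c : bool) bernoulli_pmf p c * bernoulli_pmf q (b (+) c))%R.
Proof.
by rewrite big_bool /bernoulli_pmf /xor_parameter; case: b => /=; ring.
Qed.

(** The convolution of one-bit laws, taken over n bits at once: expanding the
    product of the n two-term sums gives one term per word. *)
Lemma prod_bernoulli_pmf_xor (R : realType) (p q : R) n (b : nat -> bool) :
  (\prod_(i < n) bernoulli_pmf (xor_parameter (p, q)) (b i) =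
   \sum_(a : {ffun 'I_n -> bool})
     (\prod_(i < n) bernoulli_pmf p (extend_bits a i)) *
     (\prod_(i < n) bernoulli_pmf q (b i (+) extend_bits a i)))%R.
Proof.
under eq_bigr do rewrite bernoulli_pmf_xor.
rewrite bigA_distr_bigA; apply: eq_bigr => a _.
rewrite -big_split; apply: eq_bigr => i _.
by rewrite extend_bitsE.
Qed.

(** For each initial segment a of U, the first n bits of V are forced to be
    b + a. *)
Lemma preimage_addseq_cylinder T (U V : T -> binseq) n (b : nat -> bool) :
  (fun w => addseq (V w) (U w)) @^-1` cylinder n b =
  \bigcup_(a in [set: {ffun 'I_n -> bool}])
    (U @^-1` cylinder n (extend_bits a) `&`
     V @^-1` cylinder n (fun i => b i (+) extend_bits a i)).
Proof.
apply/seteqP; split=> [w Hw|w [a _ [Ua Va]] i ni /=]; last first.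
  by rewrite /addseq Va// Ua// -addbA addbb addbF.
exists [ffun i : 'I_n => U w i] => //; split=> i ni /=.
  by rewrite (extend_bitsE _ (Ordinal ni)) ffunE.
rewrite (extend_bitsE _ (Ordinal ni)) ffunE /= -Hw//.
by rewrite /addseq -addbA addbb addbF.
Qed.

Lemma probability_addseq_cylinder (R : realType) d (T : measurableType d)
    (P : probability T R) (U V : T -> binseq) n (b : nat -> bool) :
  measurable_fun [set: T] U -> measurable_fun [set: T] V ->
  independent P U V ->
  P ((fun w => addseq (V w) (U w)) @^-1` cylinder n b) =
  \sum_(a : {ffun 'I_n -> bool})
    P (U @^-1` cylinder n (extend_bits a)) *
    P (V @^-1` cylinder n (fun i => b i (+) extend_bits a i)).
Proof.
move=> mU mV indUV; rewrite preimage_addseq_cylinder.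
have mpre (W : T -> binseq) c : measurable_fun [set: T] W ->
    measurable (W @^-1` cylinder n c).
  by move=> mW; rewrite -[X in measurable X]setTI; apply: mW => //;
    exact: measurable_cylinder.
have fin : finite_set [set: {ffun 'I_n -> bool}] by exact: finite_finset.
rewrite measure_fin_bigcup//.
- move=> a c _ _ [w [[Ua _] [Uc _]]]; apply/ffunP => i.
  by rewrite -!extend_bitsE -Ua// -Uc.
- by move=> a _; apply: measurableI; exact: mpre.
rewrite (_ : [set: {ffun 'I_n -> bool}] =
    [set` index_enum {ffun 'I_n -> bool}]).
  by apply/seteqP; split=> // a _ /=; rewrite mem_index_enum.
rewrite -fsbig_seq ?index_enum_uniq//; apply: eq_bigr => a _.
by apply: indUV; exact: measurable_cylinder.
Qed.

Lemma product_full_measure (R : realType) d d' (S : measurableType d)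
    (T : measurableType d') (m : probability S R) (n : probability T R) A B :
  measurable A -> measurable B -> m A = 1 -> n B = 1 ->
  (m \x n) (A `*` B) = 1.
Proof.
move=> mA mB mA1 nB1; transitivity (m A * n B); first exact: product_measure1E.
by rewrite mA1 nB1 mule1.
Qed.

Lemma product_integralM (R : realType) d d' (S : measurableType d)
    (T : measurableType d') (m : probability S R) (n : probability T R)
    (f : S -> \bar R) (g : T -> \bar R) :
  measurable_fun [set: S] f -> measurable_fun [set: T] g ->
  (forall x, 0 <= f x) -> (forall y, 0 <= g y) ->
  \int[m \x n]_z (f z.1 * g z.2) = \int[m]_x f x * \int[n]_y g y.
Proof.
move=> mf mg f0 g0; rewrite fubini_tonelli1//=.
- by apply: emeasurable_funM; exact: measurableT_comp.
- by move=> z; rewrite mule_ge0.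
rewrite -ge0_integralZr//; first exact: integral_ge0.
apply: eq_integral => x _.
by rewrite /fubini_F /= ge0_integralZl.
Qed.

(** On a cylinder, both sides become integrals over the product of the mixing
    measures, whose integrands agree on the square of [0, 1] by
    [prod_bernoulli_pmf_xor]. *)
Lemma de_finetti_addseq (R : realType) d (T : measurableType d)
    (P : probability T R) (U V : T -> binseq) (mu nu : probability R R) :
  independent P U V -> de_finetti P U mu -> de_finetti P V nu ->
  de_finetti P (fun w => addseq (V w) (U w))
    (distribution (mu \x nu) (@xor_parameter R)).
Proof.
move=> indUV [mu1 mU _ [kU [iidU PU]]] [nu1 mV _ [kV [iidV PV]]].
set phi := distribution _ _.
pose I01 : set R := `[0%R, 1%R]%classic.
have mI01 : measurable I01 by exact: measurable_itv.
have mI2 : measurable (I01 `*` I01) by exact: measurableX.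
have I2_1 : (mu \x nu) (I01 `*` I01) = 1 by exact: product_full_measure.
have phi1 : phi I01 = 1.
  apply/eqP; rewrite eq_le probability_le1//= -I2_1.
  apply: le_measure; rewrite ?inE//.
    by rewrite -[X in measurable X]setTI; exact: measurable_xor_parameter.
  move=> [p q] [/= + +]; rewrite /I01 /= !in_itv /= => p01 q01.
  exact: xor_parameter_itv01.
have mUV : measurable_fun [set: T] (fun w => addseq (V w) (U w)).
  exact: measurable_addseq.
suff cond : conditionally_iid_bernoulli P (fun w => addseq (V w) (U w)) phi.
  by split=> //; exact: conditionally_iid_exchangeable cond.
(* At each parameter in [0, 1] the kernel of U is Bernoulli, so it also serves
   as the conditional law of the sum. *)
exists kU; split=> // S mS.
apply: (law_determined_by_cylinders (m := mixture phi kU)) => // n b.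
rewrite probability_addseq_cylinder//.
have mk (k : R.-pker R ~> binseq) c :
    measurable_fun [set: R] (k ^~ (cylinder n c)).
  exact: (measurable_kernel k _ (measurable_cylinder n c)).
have mUVa (a : {ffun 'I_n -> bool}) : measurable_fun [set: R * R] (fun z =>
    kU z.1 (cylinder n (extend_bits a)) *
    kV z.2 (cylinder n (fun i => b i (+) extend_bits a i))).
  apply: emeasurable_funM.
    exact: (measurableT_comp (mk kU _) measurable_fst).
  exact: (measurableT_comp (mk kV _) measurable_snd).
transitivity (\int[mu \x nu]_z (\sum_(a : {ffun 'I_n -> bool})
    (kU z.1 (cylinder n (extend_bits a)) *
     kV z.2 (cylinder n (fun i => b i (+) extend_bits a i))))).
  rewrite (ge0_integral_sum _ measurableT mUVa).
    by move=> a z _; rewrite mule_ge0.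
  apply: eq_bigr => a _.
  have mcyl := measurable_cylinder; rewrite (PU _ (mcyl _ _)) (PV _ (mcyl _ _)).
  apply/esym; apply: (product_integralM mu nu
    (f := fun p => kU p (cylinder n (extend_bits a)))
    (g := fun q => kV q (cylinder n (fun i => b i (+) extend_bits a i)))) => //;
    exact: mk.
rewrite -[RHS]/(\int[phi]_r kU r (cylinder n b)) ge0_integral_distribution//.
have := integral_eq_on_full_set (m := mu \x nu) mI2 I2_1; apply.
- by apply: emeasurable_sum => a; exact: mUVa.
- exact: measurableT_comp (mk _ _) (@measurable_xor_parameter R).
move=> [p q] [/=]; rewrite /I01 /= !in_itv /= => p01 q01.
have pq01 := xor_parameter_itv01 p01 q01.
rewrite (iid_bernoulli_cylinder n b pq01 (iidU _ pq01)) prod_bernoulli_pmf_xor.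
rewrite -sumEFin; apply: eq_bigr => a _.
by rewrite (iid_bernoulli_cylinder n _ p01 (iidU _ p01))
  (iid_bernoulli_cylinder n _ q01 (iidV _ q01)) -EFinM.
Qed.

(** * Product measures, spins and the explicit solution *)

Lemma product_probabilityE (R : realType) d d' (S : measurableType d)
    (T : measurableType d') (m : probability S R) (n : probability T R)
    (A : set (S * T)) :
  (m \x n) A = \int[m]_x n [set y | A (x, y)].
Proof. by apply: eq_integral => x _; rewrite /= xsectionE. Qed.

Lemma measurable_section_probability (R : realType) d d' (S : measurableType d)
    (T : measurableType d') (n : probability T R) (A : set (S * T)) :
  measurable A -> measurable_fun [set: S] (fun x => n [set y | A (x, y)]).
Proof.
move=> mA; have := measurable_fun_xsection n mA.
by congr (measurable_fun _ _); apply/funext => x; rewrite /= xsectionE.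
Qed.

Lemma product_distribution (R : realType) d d' e e' (S : measurableType d)
    (T : measurableType d') (S' : measurableType e) (T' : measurableType e')
    (m : probability S R) (n : probability T R)
    (f : {mfun S >-> S'}) (g : {mfun T >-> T'}) (A : set (S' * T')) :
  measurable A ->
  (distribution m f \x distribution n g) A =
  (m \x n) [set p | A (f p.1, g p.2)].
Proof.
move=> mA; rewrite !product_probabilityE ge0_integral_distribution//.
exact: measurable_section_probability.
Qed.

Lemma measurable_tuple_prod (R : realType) n :
  measurable_fun [set: n.-tuple R] (fun s => \prod_(k < n) tnth s k)%R.
Proof. by apply: measurable_prod => k _; exact: measurable_tnth. Qed.

Lemma tuple_product_prodS (R : realType) (m : nat -> probability R R) n
    (A : set R) :
  tuple_product m n.+1 [set s | A (\prod_(k < n.+1) tnth s k)%R] =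
  (m 0%N \x tuple_product (fun k => m k.+1) n)
    [set p | A (p.1 * \prod_(k < n) tnth p.2 k)%R].
Proof.
rewrite /= /distribution /pushforward; congr (product_measure1 _ _ _).
have consE x (s : n.-tuple R) :
    (\prod_(k < n.+1) tnth (cons_pair (x, s)) k =
     x * \prod_(k < n) tnth s k)%R.
  by rewrite big_ord_recl; congr (_ * _)%R; apply: eq_bigr => k _; exact: tnthS.
by apply/seteqP; split=> -[x s] /=; rewrite consE.
Qed.

Lemma product_probability_swap (R : realType) d1 d2 d3 (T1 : measurableType d1)
    (T2 : measurableType d2) (T3 : measurableType d3)
    (m1 : probability T1 R) (m2 : probability T2 R) (m3 : probability T3 R)
    (A : set (T1 * T2 * T3)) : measurable A ->
  \int[m1]_x \int[m2]_y m3 [set z | A (x, y, z)] =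
  \int[m2]_y \int[m1]_x m3 [set z | A (x, y, z)].
Proof.
move=> mA; apply: (fubini_tonelli (fun p => m3 [set z | A (p, z)])) => //.
exact: measurable_section_probability.
Qed.

(** The spin map turns the rule for parameters into multiplication
    [spin_xor_parameter], so this is a transport of the product measure along
    the two spin maps. *)
Lemma spin_law_xor (R : realType) (mu nu : probability R R) (A : set R) :
  measurable A ->
  spin_law (distribution (mu \x nu) (@xor_parameter R)) A =
  (spin_law mu \x spin_law nu) [set p | A (p.1 * p.2)%R].
Proof.
move=> mA; rewrite product_distribution.
  rewrite -[X in measurable X]setTI.
  have := @measurable_funM _ (R * R)%type R setT fst snd; apply=> //.
congr (product_measure1 _ _ _); apply/seteqP; split=> p /=;
  by rewrite spin_xor_parameter.
Qed.

Fixpoint walk_measure (R : realType) (nu phi0 : probability R R) (t : nat) :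
    probability R R :=
  if t is t'.+1
  then distribution (nu \x walk_measure nu phi0 t') (@xor_parameter R)
  else phi0.

(** The initial factor is kept separate from the t steps: a new step multiplies
    from outside, and exchanging the integrals over the new step and over the
    initial spin makes the new step part of the tuple. *)
Lemma spin_law_walk_measure (R : realType) (nu phi0 : probability R R) t
    (A : set R) : measurable A ->
  spin_law (walk_measure nu phi0 t) A =
  (spin_law phi0 \x tuple_product (fun=> spin_law nu) t)
    [set p | A (p.1 * \prod_(k < t) tnth p.2 k)%R].
Proof.
have measurable_scaled (B : set R) (x : R) :
    measurable B -> measurable [set y | B (x * y)%R].
  move=> mB; rewrite -[X in measurable X]setTI.
  have := @measurable_funM _ R R setT (cst x) id; apply=> //.
elim: t A => [|t IHt] A mA.
  (* An empty product of steps: only the initial spin is constrained. *)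
  rewrite [X in (_ \x _) X](_ : _ = A `*` [set: 0.-tuple R]).
    by apply/seteqP; split=> -[x s] /=; rewrite big_ord0 mulr1; [|case].
  transitivity (spin_law phi0 A * tuple_product (fun=> spin_law nu) 0 setT).
    by rewrite probability_setT mule1.
  by apply/esym; exact: product_measure1E.
rewrite [LHS]spin_law_xor// !product_probabilityE.
transitivity (\int[spin_law nu]_x \int[spin_law phi0]_y
    tuple_product (fun=> spin_law nu) t
      [set s | A (x * (y * \prod_(k < t) tnth s k))%R]).
  apply: eq_integral => x _.
  rewrite [LHS](IHt [set y | A (x * y)%R]) ?product_probabilityE//.
  exact: measurable_scaled.
pose B : set (R * R * t.-tuple R) :=
  [set p | A (p.1.1 * (p.1.2 * \prod_(k < t) tnth p.2 k))%R].
have mB : measurable B.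
  rewrite -[X in measurable X]setTI.
  have : measurable_fun [set: R * R * t.-tuple R]
      (fun p => p.1.1 * (p.1.2 * \prod_(k < t) tnth p.2 k))%R.
    apply: measurable_funM.
      exact: measurableT_comp measurable_fst measurable_fst.
    apply: measurable_funM.
      exact: measurableT_comp measurable_snd measurable_fst.
    exact: measurableT_comp (@measurable_tuple_prod R t) measurable_snd.
  exact.
rewrite (product_probability_swap (spin_law nu) (spin_law phi0)
  (tuple_product (fun=> spin_law nu) t) mB).
apply: eq_integral => y _.
rewrite [RHS](tuple_product_prodS (fun=> spin_law nu) t [set u | A (y * u)%R]).
rewrite product_probabilityE; apply: eq_integral => x _.
by congr (tuple_product _ _ _); apply/seteqP; split=> s /=; rewrite mulrCA.
Qed.

Theorem proposition6 (R : realType) (d : measure_display)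
    (T : measurableType d) (P : probability T R)
    (nu phi0 : probability R R) (Z X : nat -> T -> binseq)
    (Z_iid : iid P Z)
    (Z_de_finetti : forall t, de_finetti P (Z t) nu)
    (X0_de_finetti : de_finetti P (X 0%N) phi0)
    (X_step : forall t w, X t.+1 w = addseq (X t w) (Z t w))
    (Z_indep_past : forall t,
      independent P (Z t) (fun w => [tuple X i w | i < t.+1])) :
  exists phi : nat -> probability R R,
    [/\ phi 0%N = phi0,
        forall t, de_finetti P (X t) (phi t),
        forall t (A : set R), measurable A -> A `<=` `[(-1)%R, 1%R]%classic ->
          spin_law (phi t.+1) A =
          (spin_law nu \x spin_law (phi t)) [set p | A (p.1 * p.2)%R],
        forall t (A : set R), measurable A -> A `<=` `[(-1)%R, 1%R]%classic ->
          spin_law (phi t) A =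
          tuple_product
            (fun k => if k is 0 then spin_law phi0 else spin_law nu) t.+1
            [set psi | A (\prod_(k < t.+1) tnth psi k)%R] &
        forall t (A : set R), measurable A -> A `<=` `[0%R, 1%R]%classic ->
          phi t A = spin_law (phi t) [set psi | A ((1 - psi) / 2)%R]].
Proof.
(* X_t is the last entry of the past of which Z_t is independent. *)
have indep_last t : independent P (Z t) (X t).
  move=> A B mA mB.
  have mB' : measurable [set s : t.+1.-tuple binseq | B (tnth s ord_max)].
    by rewrite -[X in measurable X]setTI; exact: measurable_tnth.
  have := Z_indep_past t _ _ mA mB'.
  rewrite (_ : (fun w => [tuple X i w | i < t.+1]) @^-1` _ = X t @^-1` B)//.
  by apply/seteqP; split=> w; rewrite /preimage /= tnth_mktuple.
exists (walk_measure nu phi0); split=> //.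
- elim=> [|t IHt] //.
  rewrite (_ : X t.+1 = fun w => addseq (X t w) (Z t w)).
    by apply/funext => w; exact: X_step.
  exact: de_finetti_addseq (indep_last t) (Z_de_finetti t) IHt.
- by move=> t A mA _; exact: spin_law_xor.
- move=> t A mA _; rewrite spin_law_walk_measure//.
  apply/esym.
  exact: (tuple_product_prodS
    (fun k => if k is 0 then spin_law phi0 else spin_law nu) t A).
- move=> t A mA _; rewrite /spin_law /distribution /pushforward.
  congr (walk_measure nu phi0 t _).
  have spinK p : ((1 - spin p) / 2 = p)%R by rewrite /spin; field.
  by apply/seteqP; split=> p /=; rewrite spinK.
Qed.
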